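(* Let $S$ be a positive martingale with $S_0=1$ modelling a risky asset, and for $t>0$, $k\in\mathbb R$ let $C(t,k)=\mathbb E[(S_t-e^k)^+]$ and $P(t,k)=\mathbb E[(e^k-S_t)^+]$. Fix $\theta\in\mathbb R\setminus\{0\}$ and set $k_t=\theta\left(t\log\frac1t\right)^{1/2}$. Let $\widehat C_t$ and $\widehat P_t$ be deterministic functions with $C(t,k_t)\sim\widehat C_t$ and $P(t,k_t)\sim\widehat P_t$ as $t\downarrow0$, and define $\widehat I_t(\theta)=\widehat C_t1_{\{\theta>0\}}+\widehat P_t1_{\{\theta<0\}}$ and $I_t(\theta)=C(t,k_t)1_{\{\theta>0\}}+P(t,k_t)1_{\{\theta<0\}}$. Assume $$\frac12<\liminf_{t\downarrow0}\frac{\log I_t(\theta)}{\log t}\le\limsup_{t\downarrow0}\frac{\log I_t(\theta)}{\log t}<\infty.$$ For $x,t>0$ let $J_t(x)=\frac{\log x}{\log t}-\frac{\log\log\frac1t}{\log\frac1t}$, and put $L_t(\theta)=J_t(I_t(\theta))$, $\widehat L_t(\theta)=J_t(\widehat I_t(\theta))$. Then the implied volatility $\sigma_t(\theta):=\widehat\sigma(t,k_t)$ satisfies, as $t\downarrow0$, $$\sigma_t(\theta)=\frac{|\theta|}{\sqrt{2L_t(\theta)-1}}+\frac{|\theta|\log\frac{(2L_t(\theta)-1)^{3/2}\sqrt{2\pi}}{|\theta|}}{(2L_t(\theta)-1)^{3/2}}\frac{1}{\log\frac1t}+O\!\left(\frac{1}{\log^2\frac1t}\right),$$ and $$\sigma_t(\theta)=\frac{|\theta|}{\sqrt{2\widehat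 L_t(\theta)-1}}+\frac{|\theta|\log\frac{(2\widehat L_t(\theta)-1)^{3/2}\sqrt{2\pi}}{|\theta|}}{(2\widehat L_t(\theta)-1)^{3/2}}\frac{1}{\log\frac1t}+o\!\left(\frac{1}{\log\frac1t}\right).$$
   Context: Black–Scholes call price: $C^{\mathrm{BS}}(t,k,\sigma)=N(d_+)-e^kN(d_-)$ with $d_\pm=-\frac{k}{\sigma\sqrt t}\pm\frac{\sigma\sqrt t}{2}$, $N$ the standard normal CDF. The implied volatility $\widehat\sigma(t,k)$ is the unique $\sigma>0$ with $C^{\mathrm{BS}}(t,k,\sigma)=C(t,k)$ (equivalently, by put–call parity, matching the Black–Scholes put price $e^kN(-d_+)-N(-d_-)$ to $P(t,k)$). Notation: $f\sim g$ means $f/g\to1$; $f=o(g)$ means $f/g\to0$; $f=O(g)$ means $f/g$ bounded for small $t>0$; all as $t\downarrow0$. *)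

(* Defs.v *)
From HB Require Import structures.
From mathcomp Require Import all_boot all_order all_algebra.
From mathcomp Require Import all_classical all_reals all_analysis.
From mathcomp Require Import normal_distribution.

Set Implicit Arguments.
Unset Strict Implicit.
Unset Printing Implicit Defensive.

Import Order.TTheory GRing.Theory Num.Theory.
Import numFieldNormedType.Exports.
Local Open Scope classical_set_scope.
Local Open Scope ring_scope.

Section Defs.
Variable R : realType.

Definition normcdf (x : R) : R :=
  fine (\int[@lebesgue_measure R]_(y in `]-oo, x]) (normal_pdf 0 1 y)%:E).

Definition d_plus (t k s : R) : R := - k / (s * Num.sqrt t) + s * Num.sqrt t / 2.
Definition d_minus (t k s : R) : R := - k / (s * Num.sqrt t) - s * Num.sqrt t / 2.
Definition CBS (t k s : R) : R :=
  normcdf (d_plus t k s) - expR k * normcdf (d_minus t k s).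

(** Implied volatility: the (unique) sigma > 0 with C^BS(t,k,sigma) = c
    (a chosen one via xget; 0 if none exists). *)
Definition impvol (t k c : R) : R := xget 0 [set s : R | 0 < s /\ CBS t k s = c].

Definition is_filtration d (T : measurableType d) (F : R -> set (set T)) :=
  (forall t, 0 <= t -> sigma_algebra setT (F t) /\ F t `<=` measurable) /\
  (forall s t, 0 <= s -> s <= t -> F s `<=` F t).

Definition positive_martingale_S0_1 d (T : measurableType d)
    (P : probability T R) (F : R -> set (set T)) (S : R -> T -> R) :=
  is_filtration F /\
      (forall t, 0 <= t -> forall B : set R, measurable B -> F t (S t @^-1` B)) /\
      (forall t, 0 <= t -> P.-integrable setT (fun w => (S t w)%:E)) /\
      (forall s t, 0 <= s -> s <= t -> forall A, F s A ->
         (\int[P]_(w in A) (S t w)%:E = \int[P]_(w in A) (S s w)%:E)%E) /\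
      (forall t, 0 <= t -> {ae P, forall w, 0 < S t w}) /\
      {ae P, forall w, S 0 w = 1}.

Definition call_price d (T : measurableType d) (P : probability T R)
    (S : R -> T -> R) (t k : R) : R :=
  fine (\int[P]_w (Num.max (S t w - expR k) 0)%:E).
Definition put_price d (T : measurableType d) (P : probability T R)
    (S : R -> T -> R) (t k : R) : R :=
  fine (\int[P]_w (Num.max (expR k - S t w) 0)%:E).

Definition kt (theta t : R) : R := theta * Num.sqrt (t * ln (t^-1)).

Definition Jt (t x : R) : R := ln x / ln t - ln (ln (t^-1)) / ln (t^-1).

Definition sel (theta a b : R) : R :=
  (if 0 < theta then a else 0) + (if theta < 0 then b else 0).

Definition expansion (theta L t : R) : R :=
  `|theta| / Num.sqrt (2 * L - 1)
  + `|theta| * ln (powR (2 * L - 1) (3/2) * Num.sqrt (2 * pi) / `|theta|)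
      / powR (2 * L - 1) (3/2) * (ln (t^-1))^-1.

End Defs.

(* Main.v *)
Require Import Defs.
From HB Require Import structures.
From mathcomp Require Import all_boot all_order all_algebra.
From mathcomp Require Import ring lra.
From mathcomp Require Import all_classical all_reals all_analysis.
From mathcomp Require Import normal_distribution.

(** Write [l = ln (1/t)] and let [v = sigma * sqrt t] be the total volatility.
    The time value of the Black-Scholes call, i.e., its price minus
    [max (1 - e^k) 0], vanishes as [v -> 0+], and its derivative in [v] is
    [c * e^(k/2) * e^(- k^2/(2v^2)) * e^(- v^2/8)] with [c = 1/sqrt (2 pi)].
    Since [A v = e^(- k^2/(2v^2)) * v^3/k^2] has derivative
    [e^(- k^2/(2v^2)) * (1 + 3v^2/k^2)], comparing derivatives on [(0, v]]
    pins the time value between [c e^(k/2) e^(- v^2/8) A v / (1 + 3v^2/k^2)] and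
    [c e^(k/2) A v], for [k] of either sign.  By put-call parity [I_t] is the time
    value at [k = k_t], [v = sigma_t * sqrt t], so taking logarithms and setting
    [p = |theta| / sigma_t] gives
    [2 L_t - 1 = p^2 + (2/l) ln (sqrt (2 pi) p^3 / |theta|) + O(1/l^2)], which is
    then inverted to first order in [1/l].  Replacing [I_t] by an equivalent
    function changes the left-hand side by [o(1/l)].  As the time value is monotone
    in [v], its bounds at two fixed volatilities give both the existence of
    [sigma_t] and its confinement to a compact subset of [(0, oo)]. *)

Set Implicit Arguments.
Unset Strict Implicit.
Unset Printing Implicit Defensive.
Import Order.TTheory GRing.Theory Num.Theory.
Import numFieldNormedType.Exports.
Local Open Scope classical_set_scope.
Local Open Scope ring_scope.

(** * Black-Scholes time value *)

Lemma is_derive_normcdf (R : realType) (x : R) :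
  is_derive x 1 (@normcdf R) (normal_pdf 0 1 x).
Proof.
have xx1 : x < x + 1 by rewrite ltrDl.
have intf : (@lebesgue_measure R).-integrable
    [set` Interval -oo%O (BRight (x + 1))] (EFin \o normal_pdf 0 1).
  by apply: (integrableS _ _ (subsetT _)) => //; exact: integrable_normal_pdf.
have [//||df dfE] := continuous_FTC1 xx1 intf.
  exact: ltNyr.
  exact: (@continuous_normal_pdf R 0 1 (oner_neq0 _)).
by apply: DeriveDef; rewrite -?derive1E.
Qed.

Section normcdf_limits.
Context {R : realType}.

(** Under [normal_prob 0 1] the identity is a standard normal variable with distribution function
    [normcdf], so the limits of [cdf] carry over. *)
Let X : measurableTypeR R -> R := idfun.

#[local] HB.instance Definition _ :=
  @isMeasurableFun.Build _ _ _ _ X (@measurable_id _ _ setT).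

Lemma normcdf_cvgNy : @normcdf R @ -oo --> (0 : R).
Proof.
apply: (@fine_cvg _ _ _ _ (cdf (X : {RV normal_prob (0:R) 1 >-> R}))).
exact: cvg_cdfNy0.
Qed.

Lemma normcdf_cvgy : @normcdf R @ +oo --> (1 : R).
Proof.
apply: (@fine_cvg _ _ _ _ (cdf (X : {RV normal_prob (0:R) 1 >-> R}))).
exact: cvg_cdfy1.
Qed.

End normcdf_limits.

(* [CBS t k s] is convertible to [bs k (s * Num.sqrt t)]. *)
Definition bs {R : realType} (k v : R) : R :=
  normcdf (- k / v + v / 2) - expR k * normcdf (- k / v - v / 2).

(** Expanding the square, (-k/v + v/2)^2 / 2 = k^2/(2v^2) - k/2 + v^2/8. *)
Lemma normal_pdf_d_plus (R : realType) (k v : R) : v != 0 ->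
  normal_pdf 0 1 (- k / v + v / 2) =
  (Num.sqrt (2 * pi))^-1 * expR (k / 2) * expR (- (k ^+ 2 / (2 * v ^+ 2))) *
    expR (- (v ^+ 2 / 8)) :> R.
Proof.
move=> v0; rewrite normal_pdfE ?oner_neq0// /normal_peak /normal_fun.
rewrite -!mulrA -!expRD; congr ((Num.sqrt _)^-1 * expR _).
  by rewrite !mul1r mulr_natl.
by rewrite -(mulr_natl (1 ^+ 2)); field.
Qed.

(** The squares of -k/v - v/2 and -k/v + v/2 differ by 2k, which the factor e^k compensates. *)
Lemma normal_pdf_d_minus (R : realType) (k v : R) : v != 0 ->
  expR k * normal_pdf 0 1 (- k / v - v / 2) =
  normal_pdf 0 1 (- k / v + v / 2) :> R.
Proof.
move=> v0; rewrite !normal_pdfE ?oner_neq0// /normal_peak /normal_fun.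
rewrite mulrCA; congr (_ * _); rewrite -expRD; congr expR.
by rewrite -(mulr_natl (1 ^+ 2)); field.
Qed.

(** Both chain-rule terms carry the same density, with slopes k/v^2 + 1/2 and k/v^2 - 1/2, so only
    the difference 1 of the slopes survives. *)
Lemma is_derive_bs (R : realType) (k v : R) : 0 < v ->
  is_derive v 1 (bs k) (normal_pdf 0 1 (- k / v + v / 2)).
Proof.
move=> v0.
have v0' : v != 0 by rewrite gt_eqF.
have dV : is_derive v 1 (GRing.inv : R -> R) (- v ^- 2 *: 1).
  exact: (@is_deriveV _ id).
have dp : is_derive v 1 (fun x : R => - k / x + x / 2) (k / v ^+ 2 + 2^-1).
  have -> : (fun x : R => - k / x + x / 2) = (- k) *: GRing.inv + 2^-1 *: id.
    by apply/funext => x; rewrite [x / 2]mulrC.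
  by apply: is_derive_eq; rewrite /GRing.scale/=; field.
have dm : is_derive v 1 (fun x : R => - k / x - x / 2) (k / v ^+ 2 - 2^-1).
  have -> : (fun x : R => - k / x - x / 2) = (- k) *: GRing.inv - 2^-1 *: id.
    by apply/funext => x; rewrite [x / 2]mulrC.
  by apply: is_derive_eq; rewrite /GRing.scale/=; field.
have dNp := @is_derive1_comp _ _ (fun x => - k / x + x / 2) _ _ _
  (is_derive_normcdf _) dp.
have dNm := @is_derive1_comp _ _ (fun x => - k / x - x / 2) _ _ _
  (is_derive_normcdf _) dm.
have -> : bs k = (@normcdf R \o (fun x => - k / x + x / 2)) -
   expR k *: (@normcdf R \o (fun x => - k / x - x / 2)) by apply/funext.
apply: is_derive_eq; rewrite /GRing.scale/= mulrA normal_pdf_d_minus//; by field.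
Qed.

(** Boundary term obtained by integrating e^(-k^2/(2x^2)) by parts over (0, v]; this is [A] in the
    overview. *)
Definition tv_approx {R : realType} (k v : R) : R :=
  expR (- (k ^+ 2 / (2 * v ^+ 2))) * (v ^+ 3 / k ^+ 2).

Lemma is_derive_tv_approx (R : realType) (k v : R) : k != 0 -> 0 < v ->
  is_derive v 1 (tv_approx k)
    (expR (- (k ^+ 2 / (2 * v ^+ 2))) * (1 + 3 * v ^+ 2 / k ^+ 2)).
Proof.
move=> k0 v0; have v0' : v != 0 by rewrite gt_eqF.
have dV : is_derive v 1 (GRing.inv : R -> R) (- v ^- 2 *: 1).
  exact: (@is_deriveV _ id).
have d1 : is_derive v 1 (fun x : R => - (k ^+ 2 / (2 * x ^+ 2))) (k ^+ 2 / v ^+ 3).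
  have -> : (fun x : R => - (k ^+ 2 / (2 * x ^+ 2))) =
      (- (k ^+ 2 / 2)) *: ((GRing.inv : R -> R) * GRing.inv).
    by apply/funext => x; rewrite (expr2 x) !invfM (mulrA (k ^+ 2)) -mulNr.
  by apply: is_derive_eq; rewrite /GRing.scale/=; field.
have de := @is_derive1_comp _ _ (fun x => - (k ^+ 2 / (2 * x ^+ 2))) _ _ _
  (is_derive_expR _) d1.
have d2 : is_derive v 1 (fun x : R => x ^+ 3 / k ^+ 2) (3 * v ^+ 2 / k ^+ 2).
  have -> : (fun x : R => x ^+ 3 / k ^+ 2) = (k ^- 2) *: (id : R -> R) ^+ 3.
    by apply/funext => x; rewrite mulrC.
  by apply: is_derive_eq; rewrite /GRing.scale/=; field.
have -> : tv_approx k = (@expR R \o (fun x => - (k ^+ 2 / (2 * x ^+ 2)))) *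
   (fun x => x ^+ 3 / k ^+ 2) by apply/funext.
by apply: is_derive_eq; rewrite /GRing.scale/=; field; rewrite k0 v0'.
Qed.

(** * Behaviour at zero total volatility and comparison of derivatives *)

(** A right limit at 0 stands in for a value there, since the formulas divide by v. The mean value
    theorem on [x, v] gives f x <= f v, and x tends to 0. *)
Lemma ge0_derive_at_right0 (R : realType) (f df : R -> R) (v : R) : 0 < v ->
  (forall x, 0 < x <= v -> is_derive x 1 f (df x)) ->
  (forall x, 0 < x <= v -> 0 <= df x) ->
  f x @[x --> 0^'+] --> 0 -> 0 <= f v.
Proof.
move=> v0 fdf df0 f0.
apply: (@ler_cvg_to _ _ _ _ f (cst (f v)) 0 (f v) f0); first exact: cvg_cst.
near=> x.
have x0 : 0 < x by near: x; exact: nbhs_right_gt.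
have xv : x < v by near: x; exact: nbhs_right_lt.
have dxv y : y \in `]x, v[ -> is_derive y 1 f (df y).
  by rewrite in_itv/= => /andP[xy /ltW yv]; apply: fdf; rewrite yv (lt_trans x0).
have cxv : {within `[x, v], continuous f}.
  apply: continuous_in_subspaceT => y; rewrite inE/= in_itv/= => /andP[xy yv].
  apply: differentiable_continuous; apply/derivable1_diffP.
  by have [] := fdf y; rewrite ?yv ?(lt_le_trans x0).
have [y] := MVT xv dxv cxv; rewrite in_itv/= => /andP[xy yv] E.
rewrite /cst -subr_ge0 E mulr_ge0 ?subr_ge0 ?(ltW xv)//.
by apply: df0; rewrite (lt_trans x0 xy) ltW.
Unshelve. all: by end_near. Qed.

(** The free slope [e] covers both arguments of [normcdf] in [bs], with e = 1/2 and e = -1/2. *)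
Lemma cvg_at_right0_Ny (R : realType) (k e : R) : 0 < k ->
  - k / v + e * v @[v --> 0^'+] --> -oo.
Proof.
move=> k0; apply/cvgrNyPle => A; near=> v.
have v0 : 0 < v by near: v; exact: nbhs_right_gt.
have v1 : v < 1 by near: v; exact: nbhs_right_lt.
have D0 : 0 < `|e| + `|A| + 1 by rewrite ltr_wpDl ?addr_ge0.
have vA : v < k / (`|e| + `|A| + 1) by near: v; apply: nbhs_right_lt; exact: divr_gt0.
have kv : `|e| + `|A| + 1 <= k / v.
  by rewrite ler_pdivlMr// mulrC -ler_pdivlMr// ltW.
have ev : e * v <= `|e|.
  apply: le_trans (ler_norm _) _; rewrite normrM (gtr0_norm v0).
  by rewrite ler_piMr// ltW.
have := ler_norm (- A); rewrite normrN mulNr => hA; lra.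
Unshelve. all: by end_near. Qed.

Lemma cvg_at_right0_y (R : realType) (k e : R) : k < 0 ->
  - k / v + e * v @[v --> 0^'+] --> +oo.
Proof.
move=> k0; apply/cvgNrNy.
rewrite (_ : - _ = fun v => - (- k) / v + (- e) * v).
  by apply: cvg_at_right0_Ny; rewrite oppr_gt0.
by apply/funext => v; rewrite opprfctE !mulNr opprD.
Qed.

(** The subtracted intrinsic value is the limit of [bs k v] as v -> 0+. What is left is the
    out-of-the-money price: the call for k > 0, the put for k < 0. *)
Definition time_value {R : realType} (k v : R) : R := bs k v - Num.max (1 - expR k) 0.

Lemma time_value_cvg0 (R : realType) (k : R) : k != 0 ->
  time_value k v @[v --> 0^'+] --> 0.
Proof.
have bsE l : normcdf (- k / v + 2^-1 * v) @[v --> 0^'+] --> l ->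
    normcdf (- k / v + (- 2^-1) * v) @[v --> 0^'+] --> l ->
    time_value k v @[v --> 0^'+] --> l - expR k * l - Num.max (1 - expR k) 0.
  move=> h1 h2; apply: cvgB; last exact: cvg_cst.
  have -> : bs k = (fun v => normcdf (- k / v + 2^-1 * v) -
      expR k * normcdf (- k / v + (- 2^-1) * v)).
    by apply/funext => v; rewrite /bs !(mulrC _ v) mulrN.
  by apply: cvgB => //; apply: cvgMr.
rewrite neq_lt => /orP[k0|k0].
- have := bsE 1 (cvg_comp _ _ (cvg_at_right0_y _ k0) normcdf_cvgy)
    (cvg_comp _ _ (cvg_at_right0_y _ k0) normcdf_cvgy).
  rewrite mulr1 max_l ?subrr// subr_ge0 -expR0 ler_expR; exact: ltW.
- have := bsE 0 (cvg_comp _ _ (cvg_at_right0_Ny _ k0) normcdf_cvgNy)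
    (cvg_comp _ _ (cvg_at_right0_Ny _ k0) normcdf_cvgNy).
  rewrite mulr0 max_r ?subrr// subr_le0 -expR0 ler_expR; exact: ltW.
Qed.

Lemma is_derive_time_value (R : realType) (k v : R) : 0 < v ->
  is_derive v 1 (time_value k) (normal_pdf 0 1 (- k / v + v / 2)).
Proof.
move=> v0; have dbs := is_derive_bs k v0.
have -> : time_value k = bs k - cst (Num.max (1 - expR k) 0) by apply/funext.
by apply: is_derive_eq; rewrite subr0.
Qed.

Lemma time_value_continuous (R : realType) (k v : R) : 0 < v ->
  {for v, continuous (time_value k)}.
Proof.
move=> v0; apply: differentiable_continuous; apply/derivable1_diffP.
by have [] := is_derive_time_value k v0.
Qed.

Lemma time_value_homo (R : realType) (k : R) :
  {in Num.pos &, {homo time_value k : x y / x <= y}}.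
Proof.
move=> x y; rewrite !posrE => x0 y0; rewrite le_eqVlt => /predU1P[->//|xy].
pose df v : R := normal_pdf 0 1 (- k / v + v / 2).
have dxy z : z \in `]x, y[ -> is_derive z 1 (time_value k) (df z).
  by rewrite in_itv/= => /andP[xz _]; apply: is_derive_time_value; exact: lt_trans xz.
have cxy : {within `[x, y], continuous (time_value k)}.
  apply: continuous_in_subspaceT => z; rewrite inE/= in_itv/= => /andP[xz _].
  by apply: time_value_continuous; exact: lt_le_trans xz.
have [z _] := MVT xy dxy cxy; rewrite -subr_ge0 => ->.
by rewrite mulr_ge0 ?normal_pdf_ge0// subr_ge0 ltW.
Qed.

Lemma tv_approx_cvg0 (R : realType) (k : R) : k != 0 ->
  tv_approx k v @[v --> 0^'+] --> 0.
Proof.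
move=> k0.
have k20 : 0 < k ^+ 2 by rewrite exprn_even_gt0.
apply: (@squeeze_cvgr _ _ _ _ (cst 0) (fun v => v ^+ 3 / k ^+ 2)).
- near=> v.
  have v0 : 0 < v by near: v; exact: nbhs_right_gt.
  have A0 : 0 <= v ^+ 3 / k ^+ 2 by rewrite divr_ge0 ?(ltW k20)// exprn_ge0// ltW.
  rewrite /= /tv_approx mulr_ge0 ?expR_ge0//= ler_piMl// -[leRHS]expR0 ler_expR oppr_le0.
  by rewrite divr_ge0 ?sqr_ge0// mulr_ge0 ?sqr_ge0.
- exact: cvg_cst.
- have h : v ^+ 3 / k ^+ 2 @[v --> 0^'+] --> (0 : R) ^+ 3 / k ^+ 2.
    apply: cvg_at_right_filter; apply: cvgM; last exact: cvg_cst.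
    exact: exprn_continuous.
  by rewrite expr0n mul0r in h.
Unshelve. all: by end_near. Qed.

Lemma time_value_bounds (R : realType) (k v : R) : k != 0 -> 0 < v ->
  let c := (Num.sqrt (2 * pi))^-1 * expR (k / 2) in
  c * expR (- (v ^+ 2 / 8)) / (1 + 3 * v ^+ 2 / k ^+ 2) * tv_approx k v
    <= time_value k v /\ time_value k v <= c * tv_approx k v.
Proof.
move=> k0 v0 c.
have k20 : 0 < k ^+ 2 by rewrite exprn_even_gt0.
have c0 : 0 < c.
  by rewrite mulr_gt0 ?expR_gt0// invr_gt0 sqrtr_gt0 mulr_gt0// pi_gt0.
pose e x := expR (- (k ^+ 2 / (2 * x ^+ 2))).
have e0 x : 0 < e x by exact: expR_gt0.
pose r x := 1 + 3 * x ^+ 2 / k ^+ 2.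
have r0 x : 1 <= r x by rewrite lerDl divr_ge0 ?sqr_ge0// mulr_ge0 ?sqr_ge0.
have r0' x : 0 < r x by apply: lt_le_trans (r0 x).
have dE x : 0 < x -> normal_pdf 0 1 (- k / x + x / 2) = c * e x * expR (- (x ^+ 2 / 8)).
  by move=> x0; rewrite normal_pdf_d_plus// gt_eqF.
have cvgc b : b * tv_approx k x @[x --> 0^'+] --> 0.
  rewrite -[X in _ --> X](mulr0 b); apply: cvgMr; exact: tv_approx_cvg0.
split.
(* [b] freezes the slowly varying factors at the endpoint v, where e^(-x^2/8) is smallest and [r]
   largest on (0, v]; so b times the derivative of [tv_approx] stays below that of [time_value]. *)
- set b := c * _ / _; rewrite -subr_ge0.
  pose df x := normal_pdf 0 1 (- k / x + x / 2) - b * (e x * r x).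
  apply: (@ge0_derive_at_right0 _ (time_value k - b *: tv_approx k) df v v0).
  + move=> x /andP[x0 _].
    have d1 := is_derive_time_value k x0; have d2 := is_derive_tv_approx k0 x0.
    exact: is_derive_eq.
  + move=> x /andP[x0 xv]; rewrite /df subr_ge0 dE//.
    have xv2 : x ^+ 2 <= v ^+ 2 by rewrite ler_pXn2r// nnegrE ltW.
    have -> : b * (e x * r x) = c * e x * (expR (- (v ^+ 2 / 8)) * (r x / r v)).
      by rewrite /b -/(r v); ring.
    rewrite (ler_pM2l (mulr_gt0 c0 (e0 x))).
    apply: (@le_trans _ _ (expR (- (v ^+ 2 / 8)))).
      rewrite ler_piMr ?expR_ge0// ler_pdivrMr// mul1r lerD2l.
      by rewrite ler_pM2r ?invr_gt0// ler_pM2l.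
    by rewrite ler_expR lerN2 ler_pM2r.
  + rewrite -[X in _ --> X](subr0 0); apply: cvgB; first exact: time_value_cvg0.
    exact: cvgc.
(* For the upper bound the derivatives compare because e^(-x^2/8) <= 1 <= r x. *)
- rewrite -subr_ge0; pose f x := c * tv_approx k x - time_value k x.
  pose df x := c * (e x * r x) - normal_pdf 0 1 (- k / x + x / 2).
  apply: (@ge0_derive_at_right0 _ f df v v0).
  + move=> x /andP[x0 _]; have -> : f = c *: tv_approx k - time_value k by apply/funext.
    have d1 := is_derive_time_value k x0; have d2 := is_derive_tv_approx k0 x0.
    exact: is_derive_eq.
  + move=> x /andP[x0 xv]; rewrite /df subr_ge0 dE// -(mulrA c).
    rewrite (ler_pM2l c0) (ler_pM2l (e0 x)).
    apply: le_trans (r0 x); rewrite -[leRHS]expR0 ler_expR oppr_le0.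
    by rewrite divr_ge0 ?sqr_ge0.
  + rewrite -[X in _ --> X](subr0 0); apply: cvgB; last exact: time_value_cvg0.
    exact: cvgc.
Qed.

(** [b] is the logarithm of the upper bound in [time_value_bounds]; in the lower bound, 1 + y <= e^y
    with y = 3v^2/k^2 turns the denominator into an additive error. *)
Lemma ln_time_value_bounds (R : realType) (k v : R) : k != 0 -> 0 < v ->
  let b := k / 2 - ln (Num.sqrt (2 * pi)) - k ^+ 2 / (2 * v ^+ 2) + 3 * ln v
           - 2 * ln `|k| in
  [/\ 0 < time_value k v, b - v ^+ 2 / 8 - 3 * v ^+ 2 / k ^+ 2 <= ln (time_value k v)
    & ln (time_value k v) <= b].
Proof.
move=> k0 v0 b.
have k20 : 0 < k ^+ 2 by rewrite exprn_even_gt0.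
have s0 : 0 < Num.sqrt (2 * pi) :> R by rewrite sqrtr_gt0 mulr_gt0// pi_gt0.
have [lo hi] := time_value_bounds k0 v0.
have nk0 : 0 < `|k| by rewrite normr_gt0.
have bE : (Num.sqrt (2 * pi))^-1 * expR (k / 2) * tv_approx k v = expR b.
  rewrite /b !expRD !expRN !(expRM_natl _ (ln _)) !lnK ?posrE// /tv_approx.
  rewrite expRN real_normK ?num_real//.
  by field; rewrite k0 !gt_eqF ?expR_gt0.
have r0 : 0 < 1 + 3 * v ^+ 2 / k ^+ 2.
  by rewrite ltr_wpDr// divr_ge0 ?sqr_ge0// mulr_ge0 ?sqr_ge0.
have lo' : expR (b - v ^+ 2 / 8 - 3 * v ^+ 2 / k ^+ 2) <= time_value k v.
  apply: le_trans lo.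
  have -> (c e r A : R) : c * e / r * A = c * A * e * r^-1 by ring.
  rewrite bE !expRD (expRN (3 * v ^+ 2 / k ^+ 2)).
  rewrite ler_pM2l ?mulr_gt0 ?expR_gt0// lef_pV2 ?posrE ?expR_gt0//.
  exact: expR_ge1Dx.
have tv0 : 0 < time_value k v by apply: lt_le_trans lo'; exact: expR_gt0.
split => //; first by rewrite -ler_expR lnK.
by rewrite -ler_expR lnK// -bE.
Qed.

(** * Specialization to the log-strike [k_t] *)

Lemma ln_sqrt (R : realType) (x : R) : 0 <= x -> ln (Num.sqrt x) = ln x / 2.
Proof. by move=> x0; rewrite -powR12_sqrt// ln_powR mulrC. Qed.

(** Since k^2 = theta^2 t l and v^2 = s^2 t, the factor t cancels in k^2/v^2, which becomes theta^2
    l / s^2; and 3 ln v - 2 ln |k| contributes -l/2 - ln l. *)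
Lemma ln_time_value_kt (R : realType) (theta t s : R) :
  theta != 0 -> 0 < t -> 0 < ln t^-1 -> 0 < s ->
  let l := ln t^-1 in
  let b := kt theta t / 2 - ln (Num.sqrt (2 * pi)) - theta ^+ 2 / (2 * s ^+ 2) * l
           + 3 * ln s - l / 2 - 2 * ln `|theta| - ln l in
  let tv := time_value (kt theta t) (s * Num.sqrt t) in
  [/\ 0 < tv, b - s ^+ 2 * t / 8 - 3 * s ^+ 2 / theta ^+ 2 / l <= ln tv
    & ln tv <= b].
Proof.
move=> th0 t0 l0 s0 l b tv.
have tl0 : 0 < t * l by exact: mulr_gt0.
have st0 : 0 < Num.sqrt t by rewrite sqrtr_gt0.
have k0 : kt theta t != 0 by rewrite mulf_neq0// gt_eqF// sqrtr_gt0.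
have v0 : 0 < s * Num.sqrt t by exact: mulr_gt0.
have nth0 : 0 < `|theta| by rewrite normr_gt0.
have lt : ln t = - l by rewrite /l lnV ?posrE// opprK.
have k2 : kt theta t ^+ 2 = theta ^+ 2 * (t * l) by rewrite exprMn sqr_sqrtr// ltW.
have v2 : (s * Num.sqrt t) ^+ 2 = s ^+ 2 * t by rewrite exprMn sqr_sqrtr// ltW.
have lnk : ln `|kt theta t| = ln `|theta| - l / 2 + ln l / 2.
  rewrite normrM (ger0_norm (sqrtr_ge0 _)) lnM ?posrE ?sqrtr_gt0//.
  by rewrite ln_sqrt ?(ltW tl0)// lnM ?posrE// lt; ring.
have lnv : ln (s * Num.sqrt t) = ln s - l / 2.
  by rewrite lnM ?posrE// ln_sqrt ?(ltW t0)// lt; ring.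
have := ln_time_value_bounds k0 v0; rewrite /= lnk lnv k2 v2 -/tv.
have -> : theta ^+ 2 * (t * l) / (2 * (s ^+ 2 * t)) = theta ^+ 2 / (2 * s ^+ 2) * l.
  by field; rewrite !gt_eqF.
have -> : 3 * (s ^+ 2 * t) / (theta ^+ 2 * (t * l)) = 3 * s ^+ 2 / theta ^+ 2 / l.
  by field; rewrite th0 !gt_eqF.
have -> : kt theta t / 2 - ln (Num.sqrt (2 * pi)) - theta ^+ 2 / (2 * s ^+ 2) * l +
  3 * (ln s - l / 2) - 2 * (ln `|theta| - l / 2 + ln l / 2) = b.
  by rewrite /b; field; rewrite gt_eqF.
by [].
Qed.

(** With t = e^(-l) and e^l >= l^3/6, one gets t l <= 6/l^2 <= (3/l)^2. The bound makes the term
    k_t/2 of the log price O(1/l). *)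
Lemma kt_bound (R : realType) (theta t : R) : 0 < t -> 0 < ln t^-1 ->
  `|kt theta t| <= 3 * `|theta| / ln t^-1.
Proof.
move=> t0; set l := ln t^-1 => l0.
have tE : t^-1 = expR l by rewrite lnK// posrE invr_gt0.
have h : t * l <= 6 / l ^+ 2.
  rewrite ler_pdivlMr ?exprn_gt0// -mulrA -exprS mulrC -ler_pdivlMr//.
  have := expR_ge1Dxn 2 (ltW l0); rewrite tE => H.
  have -> : l ^+ 3 = 6 * (l ^+ 3 / 3`!%:R) by rewrite !factS fact0 /=; field.
  by rewrite ler_pM2l//; lra.
have -> : 3 * `|theta| / l = `|theta| * (3 / l) by ring.
rewrite normrM (ger0_norm (sqrtr_ge0 _)) ler_wpM2l//.
have -> : 3 / l = Num.sqrt ((3 / l) ^+ 2) by rewrite sqrtr_sqr gtr0_norm// divr_gt0.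
apply: ler_wsqrtr; apply: le_trans h _.
rewrite exprMn exprVn ler_pM2r ?invr_gt0 ?exprn_gt0//; lra.
Qed.

Lemma mul_ln_inv_le1 (R : realType) (t : R) : 0 < t -> t * ln t^-1 <= 1.
Proof.
move=> t0; rewrite mulrC -ler_pdivlMr// mul1r ltW//.
by apply: ln_sublinear; rewrite invr_gt0.
Qed.

(** Puts the expansion in the shape produced by [inversion_expansion], with b = ln (sqrt (2 pi)) -
    ln |theta|. *)
Lemma expansionE (R : realType) (theta L t : R) : theta != 0 -> 0 < 2 * L - 1 ->
  let q := Num.sqrt (2 * L - 1) in
  expansion theta L t =
    `|theta| * (q^-1 + (ln (Num.sqrt (2 * pi)) - ln `|theta| + 3 * ln q) / q ^+ 3
                        / ln t^-1).
Proof.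
move=> th0 w0 q; rewrite /expansion -/q.
have nth0 : 0 < `|theta| by rewrite normr_gt0.
have q0 : 0 < q by rewrite sqrtr_gt0.
have -> : powR (2 * L - 1) (3 / 2) = q ^+ 3.
  rewrite (mulrC 3) powRrM powR12_sqrt ?(ltW w0)// -/q.
  by rewrite (powR_mulrn 3 (ltW q0)).
have s0 : 0 < Num.sqrt (2 * pi) :> R by rewrite sqrtr_gt0 mulr_gt0// pi_gt0.
have q30 : 0 < q ^+ 3 by rewrite exprn_gt0.
rewrite ln_div ?posrE ?mulr_gt0// lnM ?posrE// (lnXn 3 q0).
by rewrite -(mulr_natl (ln q)); ring.
Qed.

(** * First-order inversion *)

Lemma ln_lipschitz (R : realType) (m x y : R) :
  0 < m -> m <= x -> m <= y -> `|ln x - ln y| <= `|x - y| / m.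
Proof.
move=> m0.
wlog xy : x y / y <= x.
  move=> H mx my; have [yx|xy] := leP y x; first exact: H.
  by rewrite distrC (distrC x); apply: H => //; exact: ltW.
move=> mx my.
have x0 : 0 < x by exact: lt_le_trans mx.
have y0 : 0 < y by exact: lt_le_trans my.
rewrite !ger0_norm ?subr_ge0 ?ler_ln// -ln_div ?posrE//.
have -> : x / y = 1 + (x - y) / y by field; rewrite gt_eqF.
apply: le_trans (le_ln1Dx _) _.
  by rewrite (lt_le_trans (ltrN10 _))// divr_ge0 ?subr_ge0// ltW.
by rewrite ler_wpM2l ?subr_ge0// lef_pV2.
Qed.

(** First-order Taylor formula for w^(-1/2) between q^2 and p^2. The remainder is an explicit
    rational function, so it is bounded by algebra alone. *)
Lemma inv_taylor (R : realFieldType) (m p q : R) : 0 < m -> m <= p -> m <= q ->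
  `|p^-1 - q^-1 - (q ^+ 2 - p ^+ 2) / (2 * q ^+ 3)| <=
  (q ^+ 2 - p ^+ 2) ^+ 2 / (2 * m ^+ 5).
Proof.
move=> m0 mp mq.
have p0 : 0 < p by exact: lt_le_trans mp.
have q0 : 0 < q by exact: lt_le_trans mq.
have pq0 : 0 < p + q by exact: addr_gt0.
have -> : p^-1 - q^-1 - (q ^+ 2 - p ^+ 2) / (2 * q ^+ 3) =
    (q ^+ 2 - p ^+ 2) ^+ 2 * ((2 * q + p) / (2 * p * q ^+ 3 * (p + q) ^+ 2)).
  by field; rewrite !gt_eqF.
rewrite ger0_norm; last first.
  rewrite mulr_ge0 ?sqr_ge0// divr_ge0//; first by rewrite ltW// addr_gt0 ?mulr_gt0.
  by rewrite ltW// !mulr_gt0 ?exprn_gt0.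
apply: ler_wpM2l; first exact: sqr_ge0.
apply: (@le_trans _ _ (p * q ^+ 3 * (p + q))^-1).
  rewrite ler_pdivrMr ?mulr_gt0 ?exprn_gt0//.
  have -> : (p * q ^+ 3 * (p + q))^-1 * (2 * p * q ^+ 3 * (p + q) ^+ 2) = 2 * (p + q).
    by field; rewrite !gt_eqF.
  lra.
rewrite lef_pV2 ?posrE ?mulr_gt0 ?exprn_gt0//.
have -> : 2 * m ^+ 5 = m * m ^+ 3 * (m + m) by ring.
have m0' := ltW m0.
apply: ler_pM; rewrite ?mulr_ge0 ?exprn_ge0 ?addr_ge0 ?lerD//.
apply: ler_pM; rewrite ?exprn_ge0//.
by rewrite ler_pXn2r// ?nnegrE ?ltW.
Qed.

(** As q^2 - p^2 = O(1/l), the Taylor remainder is O(1/l^2), and replacing ln p by ln q in the 1/l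
    term costs another O(1/l^2); E enters linearly. Constants are uniform over p in [p1, p2]. *)
Lemma inversion_expansion (R : realType) (b p1 p2 : R) : 0 < p1 ->
  exists C l0, [/\ 0 < C, 1 <= l0 & forall l p E w, l0 <= l -> p1 <= p <= p2 ->
    `|E| <= l^-1 -> w = p ^+ 2 + 2 / l * (b + 3 * ln p) + E ->
    let q := Num.sqrt w in
    [/\ 0 < w & `|p^-1 - q^-1 - (b + 3 * ln q) / q ^+ 3 / l| <= C * (`|E| + l ^- 2)]].
Proof.
move=> p10.
(* [B] bounds |b + 3 ln p| on [p1, p2], and D/l bounds |w - p^2|, the 1 in [D] accounting for |E| <=
   1/l. *)
pose B := `|b| + 3 * (`|ln p1| + `|ln p2|).
have B0 : 0 <= B by rewrite addr_ge0 ?mulr_ge0 ?addr_ge0.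
pose D := 2 * B + 1.
have D0 : 0 < D by rewrite /D; lra.
pose m := p1 / 2.
have m0 : 0 < m by rewrite /m; lra.
pose K := (D ^+ 2 + 3 * D) / (2 * m ^+ 5).
pose K' := (2 * m ^+ 3)^-1.
have K0 : 0 < K by rewrite /K divr_gt0 ?addr_gt0 ?mulr_gt0 ?exprn_gt0.
have K'0 : 0 < K' by rewrite /K' invr_gt0 mulr_gt0 ?exprn_gt0.
(* The threshold forces D/l <= 3m^2. Since p >= p1 = 2m, this gives w >= 4m^2 - 3m^2 = m^2, so q >=
   m. *)
exists (K + K'), (1 + D / (3 * m ^+ 2)); split; first exact: addr_gt0.
  by rewrite lerDl divr_ge0 ?mulr_ge0 ?exprn_ge0 ?ltW.
move=> l p E w ll /andP[pp1 pp2] El wE q.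
have l1 : 1 <= l.
  by apply: le_trans ll; rewrite lerDl divr_ge0 ?mulr_ge0 ?exprn_ge0 ?ltW.
have l0 : 0 < l by exact: lt_le_trans l1.
have p0 : 0 < p by exact: lt_le_trans pp1.
have lnp : `|b + 3 * ln p| <= B.
  have h1 : ln p1 <= ln p by rewrite ler_ln ?posrE.
  have h2 : ln p <= ln p2 by rewrite ler_ln ?posrE// (lt_le_trans p0).
  apply: le_trans (ler_normD _ _) _; rewrite /B lerD2l normrM ger0_norm// ler_pM2l//.
  rewrite ler_norml; move: (ler_norm (ln p2)) (ler_norm (- ln p1)); rewrite normrN.
  move: (normr_ge0 (ln p1)) (normr_ge0 (ln p2)) => *; lra.
pose d := w - p ^+ 2.
have dE : d = 2 / l * (b + 3 * ln p) + E by rewrite /d wE; ring.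
have dD : `|d| <= D / l.
  rewrite dE; apply: le_trans (ler_normD _ _) _.
  have -> : D / l = 2 / l * B + l^-1 by rewrite /D; ring.
  have l2 : 0 < 2 / l by rewrite divr_gt0.
  by apply: lerD => //; rewrite normrM (gtr0_norm l2) ler_pM2l.
have dm : `|d| <= 3 * m ^+ 2.
  apply: le_trans dD _; rewrite ler_pdivrMr// mulrC -ler_pdivrMr ?mulr_gt0 ?exprn_gt0//.
  by apply: le_trans ll; rewrite lerDr.
have pm : p ^+ 2 >= 4 * m ^+ 2.
  have -> : 4 * m ^+ 2 = p1 ^+ 2 by rewrite /m; field.
  by rewrite ler_pXn2r// ?nnegrE ?ltW.
have wm : m ^+ 2 <= w.
  have := ler_norm (- d); rewrite normrN; rewrite {1}/d => ?; lra.
have m20 : 0 < m ^+ 2 by rewrite exprn_gt0.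
have w0 : 0 < w by exact: lt_le_trans wm.
split => //.
have mq : m <= q by rewrite -(ger0_norm (ltW m0)) -sqrtr_sqr ler_wsqrtr.
have q0 : 0 < q by exact: lt_le_trans mq.
have mp : m <= p by rewrite (le_trans _ pp1)// /m; lra.
have qw : q ^+ 2 = w by rewrite sqr_sqrtr// ltW.
have m30 : 0 < m ^+ 3 by rewrite exprn_gt0.
have q30 : 0 < q ^+ 3 by rewrite exprn_gt0.
have mq3' : m ^+ 3 <= q ^+ 3 by rewrite ler_pXn2r// ?nnegrE ?ltW.
have mq3 : (q ^+ 3)^-1 <= (m ^+ 3)^-1 by rewrite lef_pV2.
(* The error splits into the Taylor remainder, the contribution of E, and the cost of replacing ln p
   by ln q. *)
have -> : p^-1 - q^-1 - (b + 3 * ln q) / q ^+ 3 / l =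
    (p^-1 - q^-1 - (q ^+ 2 - p ^+ 2) / (2 * q ^+ 3)) +
    (E / 2 * (q ^+ 3)^-1 - 3 * (ln q - ln p) / l * (q ^+ 3)^-1).
  have -> : q ^+ 2 - p ^+ 2 = 2 / l * (b + 3 * ln p) + E by rewrite -dE qw.
  by field; rewrite !gt_eqF.
apply: le_trans (ler_normD _ _) _.
have T1 := inv_taylor m0 mp mq.
rewrite qw -/d in T1.
have lnqp : `|ln q - ln p| <= `|d| / (2 * m ^+ 2).
  apply: le_trans (ln_lipschitz m0 mq mp) _.
  have -> : d = (q - p) * (p + q) by rewrite /d -qw; ring.
  rewrite normrM -mulrA ler_wpM2l//.
  rewrite (ger0_norm (ltW (addr_gt0 p0 q0))) ler_pdivlMr ?mulr_gt0//.
  have -> : m^-1 * (2 * m ^+ 2) = 2 * m by field; rewrite gt_eqF.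
  lra.
have T2 : `|E / 2 * (q ^+ 3)^-1| <= `|E| * K'.
  rewrite -mulrA -invfM normrM ler_wpM2l// /K'.
  by rewrite gtr0_norm ?invr_gt0 ?mulr_gt0// lef_pV2 ?posrE ?mulr_gt0// ler_pM2l.
have T3 : `|3 * (ln q - ln p) / l * (q ^+ 3)^-1| <= 3 * D / (2 * m ^+ 5) * l ^- 2.
  have -> : 3 * D / (2 * m ^+ 5) * l ^- 2 = 3 * (D / l / (2 * m ^+ 2)) / l * (m ^+ 3)^-1.
    by field; rewrite !gt_eqF.
  have q3V : 0 < (q ^+ 3)^-1 by rewrite invr_gt0.
  have lV : 0 < l^-1 by rewrite invr_gt0.
  rewrite normrM (gtr0_norm q3V); apply: ler_pM => //; first exact: ltW.
  rewrite normrM (gtr0_norm lV) (ler_pM2r lV) normrM ger0_norm// ler_pM2l//.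
  by apply: le_trans lnqp _; rewrite ler_pM2r// invr_gt0 mulr_gt0.
have T1' : d ^+ 2 / (2 * m ^+ 5) <= D ^+ 2 / (2 * m ^+ 5) * l ^- 2.
  rewrite [leRHS]mulrAC ler_pM2r ?invr_gt0 ?mulr_gt0 ?exprn_gt0//.
  rewrite -exprVn -exprMn -real_normK ?num_real//.
  by rewrite ler_pXn2r// nnegrE divr_ge0// ltW.
have -> : (K + K') * (`|E| + l ^- 2) =
   D ^+ 2 / (2 * m ^+ 5) * l ^- 2 + (`|E| * K' + 3 * D / (2 * m ^+ 5) * l ^- 2) +
   (K * `|E| + K' * l ^- 2) by rewrite /K; ring.
apply: ler_wpDr.
  by rewrite addr_ge0// mulr_ge0 ?(ltW K0) ?(ltW K'0) ?invr_ge0 ?exprn_ge0 ?(ltW l0).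
apply: lerD; first by rewrite qw; exact: le_trans T1 T1'.
by apply: le_trans (ler_normB _ _) _; exact: lerD.
Qed.

(** * Prices and implied volatility *)

(** The lower limit is a supremum of infima over sets of the filter, so one of these infima exceeds
    a; if it is +oo, b = a + 1 serves. *)
Lemma limf_einf_gt (R : realType) (f : R -> R) (F : set_system R)
    {FF : Filter F} (a : R) :
  (a%:E < limf_einf (fun x => (f x)%:E) F)%E ->
  exists2 b, a < b & \forall x \near F, b <= f x.
Proof.
rewrite limf_einfE => /ereal_sup_gt[_ [V FV <-]] aV.
have [b ab bV] : exists2 b : R, a < b & (b%:E <= ereal_inf [set (f x)%:E | x in V])%E.
  case: (ereal_inf _) aV => [r| |]//.
    by rewrite lte_fin => ar; exists r.
  by move=> _; exists (a + 1); rewrite ?ltrDl ?leey.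
exists b => //; apply: filterS FV => x Vx.
by rewrite -lee_fin (le_trans bV)//; apply: ereal_inf_lbound; exists x.
Qed.

Lemma limf_esup_lty (R : realType) (f : R -> R) (F : set_system R) {FF : Filter F} :
  (limf_esup (fun x => (f x)%:E) F < +oo)%E ->
  exists K, \forall x \near F, f x <= K.
Proof.
rewrite limf_esupE => /ereal_inf_lt[_ [V FV <-]] Vy.
have [K VK] : exists K : R, (ereal_sup [set (f x)%:E | x in V] <= K%:E)%E.
  by case: (ereal_sup _) Vy => [r| |]// _; [exists r|exists 0; rewrite leNye].
exists K; apply: filterS FV => x Vx.
by rewrite -lee_fin (le_trans _ VK)//; apply: ereal_sup_ubound; exists x.
Qed.

Lemma martingale_expectation (R : realType) (d : measure_display)
    (T : measurableType d) (P : probability T R) F (S : R -> T -> R) (t : R) :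
  positive_martingale_S0_1 P F S -> 0 <= t -> (\int[P]_w (S t w)%:E = 1)%E.
Proof.
move=> [[Fsig _] [_ [Sint [Smart [_ S01]]]]] t0.
have [[F00 FC _] _] := Fsig 0 (lexx 0).
have FT : F 0 setT by have := FC _ F00; rewrite setD0.
rewrite (Smart 0 t (lexx 0) t0 setT FT).
have : (\int[P]_w (S 0 w)%:E = \int[P]_w (cst 1%E) w)%E.
  apply: ae_eq_integral => //.
    by have /integrableP[] := Sint 0 (lexx 0).
  by apply: filterS S01 => w /= -> .
move=> ->; rewrite integral_cst// -[RHS]mule1; congr (_ * _)%E.
exact: probability_setT.
Qed.

(** Integrate max(x, 0) - max(-x, 0) = x at x = S_t - e^k. *)
Lemma put_call_parity (R : realType) (d : measure_display)
    (T : measurableType d) (P : probability T R) (S : R -> T -> R) (t k : R) :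
  P.-integrable setT (fun w => (S t w)%:E) -> (\int[P]_w (S t w)%:E = 1)%E ->
  call_price P S t k - put_price P S t k = 1 - expR k.
Proof.
move=> iS ES; rewrite /call_price /put_price.
have iK : P.-integrable setT (fun w => (expR k)%:E).
  by apply: finite_measure_integrable_cst.
have i1 : P.-integrable setT (fun w => (Num.max (S t w - expR k) 0)%:E).
  apply: (@integrable_funrpos _ _ _ _ _ (fun w => S t w - expR k)) => //.
  exact: (integrableB measurableT iS iK).
have i2 : P.-integrable setT (fun w => (Num.max (expR k - S t w) 0)%:E).
  apply: (@integrable_funrpos _ _ _ _ _ (fun w => expR k - S t w)) => //.
  exact: (integrableB measurableT iK iS).
rewrite -fineB; [|exact: integral_fune_fin_num..].
rewrite -integralB_EFin//.
transitivity (fine (\int[P]_w (S t w - expR k)%:E)).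
  congr fine; apply: eq_integral => w _; congr EFin.
  rewrite !maxEle; case: ifP; case: ifP; lra.
under eq_integral do rewrite EFinB.
rewrite integralB// ES integral_cst//.
have -> : ((expR k)%:E * P setT = (expR k)%:E)%E; last by [].
by rewrite -[RHS]mule1; congr (_ * _)%E; exact: probability_setT.
Qed.

(** * From prices to volatilities: expansion and confinement *)

(** The price x may differ from the time value by a log error e, so that one estimate serves I_t,
    where e = 0, and its equivalent, where e -> 0. *)
Lemma volatility_expansion (R : realType) (theta s1 s2 : R) : theta != 0 -> 0 < s1 ->
  exists C l0, [/\ 0 < C, 1 <= l0 & forall t s x, 0 < t -> l0 <= ln t^-1 ->
    s1 <= s <= s2 -> 0 < x ->
    let e := `|ln x - ln (time_value (kt theta t) (s * Num.sqrt t))| in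
    e <= 4^-1 ->
    `|s - expansion theta (Jt t x) t| <= C * (e / ln t^-1 + (ln t^-1) ^- 2)].
Proof.
move=> th0 s10.
have nth0 : 0 < `|theta| by rewrite normr_gt0.
have th20 : 0 < theta ^+ 2 by rewrite exprn_even_gt0.
have [s21|s12] := ltP s2 s1.
  exists 1, 1; split => // t s x _ _ /andP[h1 h2].
  by have := le_lt_trans (le_trans h1 h2) s21; rewrite ltxx.
have s20 : 0 < s2 by exact: lt_le_trans s12.
pose bb : R := ln (Num.sqrt (2 * pi)) - ln `|theta|.
have p10 : 0 < `|theta| / s2 by exact: divr_gt0.
have [C [l0 [C0 l01 H]]] := inversion_expansion bb (`|theta| / s1) p10.
(* The first two terms are twice the errors v^2/8 and 3v^2/k^2 in the log price, the third comes
   from [kt_bound]; each is scaled by l. *)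
pose M := s2 ^+ 2 / 4 + 6 * s2 ^+ 2 / theta ^+ 2 + 3 * `|theta|.
have s220 : 0 < s2 ^+ 2 by rewrite exprn_gt0.
have M0 : 0 < M.
  by rewrite !addr_gt0 ?(divr_gt0 s220)// ?divr_gt0// mulr_gt0.
(* l >= 2M gives M/l <= 1/2, and e <= 1/4 gives 2e <= 1/2; together they yield the required |E| <=
   1/l. *)
exists (`|theta| * C * (2 + (M + 1))), (l0 + 2 * M); split.
- by rewrite mulr_gt0 ?(mulr_gt0 nth0 C0)//; lra.
- by rewrite ler_wpDr// mulr_ge0// ltW.
move=> t s x t0; set l := ln t^-1 => l0l /andP[s1s ss2] x0 e e4.
have s0 : 0 < s by exact: lt_le_trans s1s.
have Ml : 2 * M <= l by apply: le_trans l0l; rewrite lerDr; lra.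
have l0l' : l0 <= l by apply: le_trans l0l; rewrite lerDl mulr_ge0// ltW.
have lp : 0 < l by lra.
have l1 : 1 <= l by lra.
have [tv0] := ln_time_value_kt th0 t0 lp s0; rewrite -/l.
rewrite {}/e in e4 *; set y := ln (time_value _ _) in e4 *.
set e := `|ln x - y| in e4 *.
set b := kt _ _ / 2 - _ - _ + _ - _ - _ - _ => lo hi.
(* What remains of 2 Jt - 1 beyond p^2 + (2/l)(bb + 3 ln p) with p = |theta|/s: the log-log term of
   [Jt] cancels ln l, and the -1 cancels the l/2 in [b]. *)
pose E := (2 * (b - y) - kt theta t - 2 * (ln x - y)) / l.
have e0 : 0 <= e by exact: normr_ge0.
have lV0 : 0 < l^-1 by rewrite invr_gt0.
have r1 : s ^+ 2 * t <= s2 ^+ 2 / l.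
  apply: ler_pM; rewrite ?exprn_ge0 ?(ltW t0) ?(ltW s0)//.
    by rewrite ler_pXn2r// nnegrE ltW.
  by rewrite -[leRHS]mul1r ler_pdivlMr// mul_ln_inv_le1.
have r2 : 3 * s ^+ 2 / theta ^+ 2 / l <= 3 * s2 ^+ 2 / theta ^+ 2 / l.
  rewrite !ler_pM2r ?invr_gt0// ler_pM2l//.
  by rewrite ler_pXn2r// nnegrE ltW.
have ktb := kt_bound theta t0 lp.
have EM : `|E| <= M / l ^+ 2 + 2 * e / l.
  have -> : M / l ^+ 2 + 2 * e / l = (M / l + 2 * e) / l by field; rewrite gt_eqF.
  rewrite /E normrM (gtr0_norm lV0) ler_pM2r//.
  apply: le_trans (ler_normB _ _) _; apply: lerD; last by rewrite normrM ger0_norm.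
  apply: le_trans (ler_normB _ _) _.
  have -> : M / l =
      (s2 ^+ 2 / l / 4 + 2 * (3 * s2 ^+ 2 / theta ^+ 2 / l)) + 3 * `|theta| / l.
    by rewrite /M; field; rewrite th0 gt_eqF.
  apply: lerD => //; rewrite ger0_norm; lra.
have El : `|E| <= l^-1.
  apply: le_trans EM _.
  have -> : M / l ^+ 2 + 2 * e / l = (M / l + 2 * e) * l^-1 by field; rewrite gt_eqF.
  rewrite ler_piMl ?(ltW lV0)//.
  have : M / l <= 2^-1 by rewrite ler_pdivrMr//; lra.
  by lra.
have wE : 2 * Jt t x - 1 = (`|theta| / s) ^+ 2 + 2 / l * (bb + 3 * ln (`|theta| / s)) + E.
  have lt : ln t = - l by rewrite /l lnV ?posrE// opprK.
  rewrite /Jt -/l lt ln_div ?posrE// exprMn real_normK ?num_real// /E /b /bb.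
  by field; rewrite !gt_eqF.
have pp : `|theta| / s2 <= `|theta| / s <= `|theta| / s1.
  by rewrite !(ler_pM2l nth0) !lef_pV2 ?posrE// ss2 s1s.
have [w0] := H l _ E _ l0l' pp El wE.
set q := Num.sqrt _ => HH.
rewrite (expansionE _ th0 w0) -/q -/l -/bb.
have -> : s - `|theta| * (q^-1 + (bb + 3 * ln q) / q ^+ 3 / l) =
  `|theta| * ((`|theta| / s)^-1 - q^-1 - (bb + 3 * ln q) / q ^+ 3 / l).
  rewrite invf_div; move: q^-1 (_ / q ^+ 3 / l) => X Y.
  by field; rewrite gt_eqF.
rewrite normrM (gtr0_norm nth0) -2!(mulrA `|theta|) (ler_pM2l nth0).
apply: le_trans HH _; rewrite -(mulrA C) (ler_pM2l C0).
apply: (@le_trans _ _ (M / l ^+ 2 + 2 * e / l + l ^- 2)); first by rewrite lerD2r.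
have eV0 : 0 <= e / l by rewrite mulr_ge0// ltW.
have l2V0 : 0 < l ^- 2 by rewrite invr_gt0 exprn_gt0.
rewrite -subr_ge0.
have -> : (2 + (M + 1)) * (e / l + l ^- 2) - (M / l ^+ 2 + 2 * e / l + l ^- 2) =
  (M + 1) * (e / l) + 2 * l ^- 2 by ring.
by rewrite addr_ge0// mulr_ge0// ?ltW// addr_gt0.
Qed.

(** The target x lies strictly between the time values at s1 and s2. The intermediate value theorem
    gives a solution, and monotonicity places the chosen one in [s1, s2]. *)
Lemma impvol_bounds (R : realType) (theta e K : R) : theta != 0 -> 0 < e ->
  exists s1 s2 l0, [/\ 0 < s1, 1 <= l0 & forall t c, 0 < t -> l0 <= ln t^-1 ->
    let k := kt theta t in
    let x := c - Num.max (1 - expR k) 0 in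
    0 < x -> (2^-1 + e) * ln t^-1 <= - ln x <= K * ln t^-1 ->
    let s := impvol t k c in
    s1 <= s <= s2 /\ time_value k (s * Num.sqrt t) = x].
Proof.
move=> th0 e0.
have nth0 : 0 < `|theta| by rewrite normr_gt0.
have th20 : 0 < theta ^+ 2 by rewrite exprn_even_gt0.
(* At a fixed volatility [u] the time value is [t ^ (1/2 + theta^2/(2u^2) + o(1))];
   the exponent exceeds [K] at [s1] and is below [1/2 + e] at [s2]. *)
pose s1 := `|theta| / Num.sqrt (2 * (`|K| + 1)).
pose s2 := `|theta| / Num.sqrt e.
have K0 : 0 < 2 * (`|K| + 1) by rewrite mulr_gt0// ltr_wpDl.
have s10 : 0 < s1 by rewrite divr_gt0// sqrtr_gt0.
have s20 : 0 < s2 by rewrite divr_gt0// sqrtr_gt0.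
have s1E : theta ^+ 2 / (2 * s1 ^+ 2) = `|K| + 1.
  rewrite /s1 exprMn exprVn sqr_sqrtr ?(ltW K0)// real_normK ?num_real//.
  by field; rewrite th0 gt_eqF// ltr_wpDl.
have s2E : theta ^+ 2 / (2 * s2 ^+ 2) = e / 2.
  rewrite /s2 exprMn exprVn sqr_sqrtr ?(ltW e0)// real_normK ?num_real//.
  by field; rewrite th0 gt_eqF.
pose A s : R := - ln (Num.sqrt (2 * pi)) + 3 * ln s - 2 * ln `|theta|.
(* At s2 the exponents 1/2 + e and 1/2 + e/2 leave a margin (e/2) l: one half absorbs ln l up to the
   constant ln (4/e), the other absorbs [B], which gathers all bounded terms. *)
pose B := 2 * `|theta| + `|A s2| + s2 ^+ 2 / 8 + 3 * s2 ^+ 2 / theta ^+ 2 + `|ln (4 / e)|.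
pose l0 := 1 + 2 * `|theta| + `|A s1| + 4 / e * (B + 1).
have B0 : 0 <= B.
  rewrite !addr_ge0 ?normr_ge0 ?mulr_ge0 ?invr_ge0 ?sqr_ge0//.
have Be0 : 0 <= 4 / e * (B + 1).
  by rewrite mulr_ge0 ?divr_ge0 ?(ltW e0)// addr_ge0.
exists s1, s2, l0; split => //.
  by have := normr_ge0 (A s1); rewrite /l0; lra.
move=> t c t0; set l := ln t^-1 => l0l k x x0 /andP[xlo xhi] s.
have nA1 := ler_norm (A s1); have nA2 := ler_norm (- A s2); rewrite normrN in nA2.
have n1 := normr_ge0 (A s1).
have l1 : 1 + 2 * `|theta| + `|A s1| <= l by apply: le_trans l0l; rewrite lerDl.
have l1' : 1 <= l by lra.
have lp : 0 < l by lra.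
have lB : B + 1 <= e / 4 * l.
  have -> : B + 1 = e / 4 * (4 / e * (B + 1)) by field; rewrite gt_eqF.
  by rewrite ler_pM2l ?divr_gt0// (le_trans _ l0l)// /l0; lra.
have lnl0 : 0 <= ln l by exact: ln_ge0.
have lnl : ln l <= e / 4 * l + `|ln (4 / e)|.
  have e40 : 0 < 4 / e by exact: divr_gt0.
  have el0 : 0 < e / 4 * l by apply: mulr_gt0 => //; exact: divr_gt0.
  have -> : ln l = ln (e / 4 * l) + ln (4 / e).
    by rewrite -lnM ?posrE//; congr ln; field; rewrite gt_eqF.
  by apply: lerD; [exact/ltW/ln_sublinear|exact: ler_norm].
have t1 : t <= 1.
  have := mul_ln_inv_le1 t0; rewrite -/l; apply: le_trans.
  by rewrite ler_peMr// ltW.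
have kb : `|k| <= 3 * `|theta|.
  apply: le_trans (kt_bound theta t0 lp) _; rewrite ler_pdivrMr// ler_peMr//.
have k1 := ler_norm k; have k2 := ler_norm (- k); rewrite normrN in k2.
have st0 : 0 < Num.sqrt t by rewrite sqrtr_gt0.
pose v u := u * Num.sqrt t.
have v0 u : 0 < u -> 0 < v u by move=> u0; exact: mulr_gt0.
have lo : time_value k (v s1) < x.
  have [tv0 _] := ln_time_value_kt th0 t0 lp s10; rewrite -/l -/k -/(v s1) s1E => H.
  rewrite -ltr_ln ?posrE//; apply: le_lt_trans H _.
  have Kl : K * l <= `|K| * l by rewrite ler_pM2r// ler_norm.
  have AE : A s1 = - ln (Num.sqrt (2 * pi)) + 3 * ln s1 - 2 * ln `|theta| by [].
  rewrite (mulrDl `|K|); lra.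
have hi : x < time_value k (v s2).
  have [tv0 + _] := ln_time_value_kt th0 t0 lp s20; rewrite -/l -/k -/(v s2) s2E => H.
  rewrite -ltr_ln ?posrE//; apply: lt_le_trans H.
  have h1 : s2 ^+ 2 * t <= s2 ^+ 2 by rewrite ler_piMr// sqr_ge0.
  have h2 : 3 * s2 ^+ 2 / theta ^+ 2 / l <= 3 * s2 ^+ 2 / theta ^+ 2.
    rewrite ler_pdivrMr// ler_peMr// divr_ge0 ?sqr_ge0// mulr_ge0 ?sqr_ge0//.
  have AE : A s2 = - ln (Num.sqrt (2 * pi)) + 3 * ln s2 - 2 * ln `|theta| by [].
  rewrite (mulrDl 2^-1) in xlo; rewrite /B in lB; lra.
have mono u u' : 0 < u -> 0 < u' -> time_value k (v u) < time_value k (v u') -> u <= u'.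
  move=> u0 u'0; apply: contraTT; rewrite -ltNge -leNgt => uu'.
  by apply: time_value_homo; rewrite ?posrE ?v0// ler_pM2r// ltW.
have s12 := mono _ _ s10 s20 (lt_trans lo hi).
have vv : v s1 <= v s2 by rewrite ler_pM2r.
have cont : {within `[v s1, v s2], continuous (time_value k)}.
  apply: continuous_in_subspaceT => z; rewrite inE/= in_itv/= => /andP[xz _].
  by apply: time_value_continuous; apply: lt_le_trans xz; exact: v0.
have [|z] := IVT vv cont (v := x).
  by rewrite ge_min le_max (ltW lo) (ltW hi) orbT.
rewrite in_itv/= => /andP[z1 z2] zx.
(* Since the solution set is nonempty, [impvol] does not take its default value 0. *)
have [sp sE] : 0 < s /\ CBS t k s = c.
  apply: (@xgetPex _ 0 [set u : R | 0 < u /\ CBS t k u = c]).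
  exists (z / Num.sqrt t) => /=; split.
    by rewrite divr_gt0// (lt_le_trans (v0 _ s10)).
  rewrite -[CBS _ _ _]/(bs k (z / Num.sqrt t * Num.sqrt t)) divfK ?gt_eqF//.
  by move: zx; rewrite /time_value /x => /addIr.
have tvE : time_value k (v s) = x by rewrite /x -sE.
split => //; apply/andP; split; apply: mono => //; by rewrite tvE.
Qed.

(** * Small-time asymptotics along [k_t] *)

Lemma near_ln_inv_ge (R : realType) (A : R) : \forall t \near 0^'+, A <= ln t^-1.
Proof.
near=> t.
have t0 : 0 < t by near: t; exact: nbhs_right_gt.
rewrite lnV ?posrE// lerNr; near: t.
by move/cvgrNyPle : (@lnNy R); apply.
Unshelve. all: by end_near. Qed.

(** k_t has the sign of theta: for theta > 0 the intrinsic value is 0, and for theta < 0 it is 1 -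
    e^k, so parity turns the call into the put. *)
Lemma sel_price_time_value (R : realType) (d : measure_display) (T : measurableType d)
    (P : probability T R) F (S : R -> T -> R) (theta t : R) :
  positive_martingale_S0_1 P F S -> theta != 0 -> 0 < t -> 0 < ln t^-1 ->
  let k := kt theta t in
  sel theta (call_price P S t k) (put_price P S t k) =
  call_price P S t k - Num.max (1 - expR k) 0.
Proof.
move=> mart th0 t0 l0 k.
have s0 : 0 < Num.sqrt (t * ln t^-1) by rewrite sqrtr_gt0 mulr_gt0.
rewrite /sel; move: th0; rewrite neq_lt => /orP[th0|th0].
- have k0 : k < 0 by rewrite pmulr_llt0.
  rewrite th0 (lt_gtF th0) add0r max_l ?subr_ge0 -?expR0 ?ler_expR ?(ltW k0)//.
  have iS : P.-integrable setT (fun w => (S t w)%:E).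
    by case: mart => _ [_ [+ _]]; apply; exact: ltW.
  have := put_call_parity k iS (martingale_expectation mart (ltW t0)).
  by rewrite expR0 => <-; ring.
- have k0 : 0 < k by exact: mulr_gt0.
  by rewrite th0 (lt_gtF th0) addr0 max_r ?subr0// subr_le0 -expR0 ler_expR ltW.
Qed.

Theorem theorem3p1 (R : realType) (d : measure_display) (T : measurableType d)
  (P : probability T R) (F : R -> set (set T)) (S : R -> T -> R)
  (theta : R) (Chat Phat : R -> R) :
  positive_martingale_S0_1 P F S ->
  theta != 0 ->
  (* C(t,k_t) ~ Chat_t and P(t,k_t) ~ Phat_t as t -> 0+ *)
  (fun t => call_price P S t (kt theta t) / Chat t) @ 0^'+ --> (1 : R) ->
  (fun t => put_price P S t (kt theta t) / Phat t) @ 0^'+ --> (1 : R) ->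
  (let I := fun t => sel theta (call_price P S t (kt theta t))
                               (put_price P S t (kt theta t)) in
   (1/2)%:E < limf_einf (fun t => (ln (I t) / ln t)%:E) 0^'+ /\
   limf_esup (fun t => (ln (I t) / ln t)%:E) 0^'+ < +oo)%E ->
  let I := fun t => sel theta (call_price P S t (kt theta t))
                              (put_price P S t (kt theta t)) in
  let Ihat := fun t => sel theta (Chat t) (Phat t) in
  let sigma := fun t => impvol t (kt theta t) (call_price P S t (kt theta t)) in
  (exists M : R, \forall t \near 0^'+,
     `|sigma t - expansion theta (Jt t (I t)) t| <= M / (ln (t^-1)) ^+ 2) /\
  (forall eps : R, 0 < eps -> \forall t \near 0^'+,
     `|sigma t - expansion theta (Jt t (Ihat t)) t| <= eps / ln (t^-1)).
Proof.
move=> mart th0 hC hP [hinf hsup] I Ihat sigma.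
have [h hgt nearlo] := limf_einf_gt hinf.
have [K nearhi] := limf_esup_lty hsup.
rewrite -/I in nearlo nearhi.
have e0 : 0 < h - 2^-1 by rewrite subr_gt0 -div1r.
have [s1 [s2 [l1 [s10 l11 Hvol]]]] := impvol_bounds K th0 e0.
have [C [l2 [C0 l21 Hexp]]] := volatility_expansion s2 th0 s10.
have core : \forall t \near 0^'+, [/\ 0 < t, 0 < I t, s1 <= sigma t <= s2
    & time_value (kt theta t) (sigma t * Num.sqrt t) = I t].
  near=> t.
  have t0 : 0 < t by near: t; exact: nbhs_right_gt.
  have l1l : l1 <= ln t^-1 by near: t; exact: near_ln_inv_ge.
  have lp : 0 < ln t^-1 by exact: lt_le_trans (lt_le_trans ltr01 l11) l1l.
  have lt : ln t = - ln t^-1 by rewrite lnV ?posrE// opprK.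
  have It : I t = _ := sel_price_time_value mart th0 t0 lp.
  have lo : h <= ln (I t) / ln t by near: t.
  have hi : ln (I t) / ln t <= K by near: t.
  rewrite lt invrN mulrN -mulNr in lo hi.
  rewrite ler_pdivlMr// in lo; rewrite ler_pdivrMr// in hi.
  (* [ln] is 0 at nonpositive reals, so I_t <= 0 would contradict h l <= - ln I_t with h > 1/2. *)
  have I0 : 0 < I t.
    rewrite ltNge; apply/negP => /ln0 I0; move: lo; rewrite I0 oppr0.
    apply/negP; rewrite -ltNge mulr_gt0//; lra.
  have [] := Hvol t (call_price P S t (kt theta t)) t0 l1l; rewrite -?It//.
  by rewrite subrKC lo hi.
split.
- exists C; near=> t.
  have [t0 I0 ss tvE] : [/\ 0 < t, 0 < I t, s1 <= sigma t <= s2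
    & time_value (kt theta t) (sigma t * Num.sqrt t) = I t] by near: t.
  have l2l : l2 <= ln t^-1 by near: t; exact: near_ln_inv_ge.
  have := Hexp t (sigma t) (I t) t0 l2l ss I0.
  by rewrite /= tvE subrr normr0 mul0r add0r; apply; rewrite invr_ge0.
move=> eps eps0.
have ratio : I t / Ihat t @[t --> 0^'+] --> (1 : R).
  rewrite /I /Ihat /sel; move: th0; rewrite neq_lt => /orP[th0|th0].
  + by rewrite th0 (lt_gtF th0); under eq_fun do rewrite !add0r.
  + by rewrite th0 (lt_gtF th0); under eq_fun do rewrite !addr0.
have lnratio : ln (I t / Ihat t) @[t --> 0^'+] --> (0 : R).
  rewrite -[X in _ --> X](@ln1 R); apply: cvg_comp ratio _.
  exact: (@continuous_ln R 1 ltr01).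
pose eta := Num.min 4^-1 (eps / (2 * C)).
have eta0 : 0 < eta by rewrite lt_min invr_gt0 ltr0n divr_gt0// mulr_gt0.
near=> t.
have [t0 I0 ss tvE] : [/\ 0 < t, 0 < I t, s1 <= sigma t <= s2
  & time_value (kt theta t) (sigma t * Num.sqrt t) = I t] by near: t.
have l2l : l2 <= ln t^-1 by near: t; exact: near_ln_inv_ge.
have lp : 0 < ln t^-1 by exact: lt_le_trans (lt_le_trans ltr01 l21) l2l.
have leps : 2 * C / eps <= ln t^-1 by near: t; exact: near_ln_inv_ge.
have r0 : 0 < I t / Ihat t by near: t; exact: (cvgr_gt 1 ratio 0 ltr01).
(* The sign of the equivalent is inherited from I_t, as their ratio tends to 1. *)
have Ih0 : 0 < Ihat t by rewrite -invr_gt0 -(pmulr_rgt0 _ I0).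
have lneta : `|ln (Ihat t) - ln (I t)| <= eta.
  have : `|0 - ln (I t / Ihat t)| < eta.
    by near: t; move/cvgrPdist_lt : lnratio; exact.
  by rewrite ln_div ?posrE// sub0r opprB => /ltW.
have := Hexp t (sigma t) (Ihat t) t0 l2l ss Ih0; rewrite /= tvE => H.
apply: le_trans (H _) _.
  by apply: le_trans lneta _; rewrite ge_min lexx.
set l := ln t^-1 in lp leps *.
have -> : C * (`|ln (Ihat t) - ln (I t)| / l + l ^- 2) =
    C * (`|ln (Ihat t) - ln (I t)| + l^-1) / l by field; rewrite gt_eqF.
rewrite ler_pM2r ?invr_gt0// mulrDr.
have h1 : C * `|ln (Ihat t) - ln (I t)| <= eps / 2.
  have -> : eps / 2 = C * (eps / (2 * C)) by field; rewrite gt_eqF.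
  by rewrite ler_pM2l//; apply: le_trans lneta _; rewrite ge_min lexx orbT.
have h2 : C / l <= eps / 2.
  rewrite ler_pdivrMr//; move: leps; rewrite ler_pdivrMr// => leps; lra.
lra.
Unshelve. all: by end_near. Qed.
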